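(* For every $N>2$, every integer $\ell$ and every $x$ with $1\le x\le N-1$, $$R(N,\ell,x)=\sum_{i=\max(x,2)}^{N-2} R(N-1,\ell-1,i)+\sum_{i=1}^{\max(x-1,1)} R(N-1,\ell,i).$$
   Context: A recursive tree on $N$ vertices is a tree whose vertices are labeled $0,1,\dots,N-1$, rooted at $0$, such that labels strictly increase along every path from the root. Its smallest rooted path is the path starting at the root that at each vertex proceeds to the child with the smallest label, until it reaches a vertex with no children. $R(N,\ell,x)$ denotes the number of recursive trees on $N$ vertices having exactly $\ell$ vertices of degree $1$ (the root counts if it has degree $1$) and whose smallest rooted path ends at the vertex labeled $x$. *)

(* Defs.v *)
From mathcomp Require Import all_boot all_order all_algebra.
From mathcomp Require Import boolp.

Set Implicit Arguments.
Unset Strict Implicit.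
Unset Printing Implicit Defensive.

Section Graph.

Variable V : finType.
Implicit Types (E : {set {set V}}) (u v : V).

(* A simple graph on V is given by its set of edges, i.e. of 2-element sets. *)
Definition simple_graph E : Prop := forall e, e \in E -> #|e| = 2.

Definition adj E : rel V := fun u v => [set u; v] \in E.

Definition degree E u : nat := #|[set v | adj E u v]|.

Definition num_leaves E : nat := #|[set u | degree E u == 1]|.

Definition graph_connected E : Prop := forall u v, connect (adj E) u v.

(* [ucycle] also accepts the degenerate cycles [:: u; v] that traverse one edge
   back and forth, so genuine cycles are those with at least 3 vertices. *)
Definition graph_acyclic E : Prop :=
  forall c : seq V, 2 < size c -> ~ ucycle (adj E) c.

Definition is_tree E : Prop :=
  [/\ simple_graph E, graph_connected E & graph_acyclic E].

End Graph.

Section RecursiveTree.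

Variable n : nat.
Implicit Types (E : {set {set 'I_n.+1}}) (u v w x : 'I_n.+1).

(* [p] lists the vertices that follow the root [ord0] on the path. *)
Definition root_path E (p : seq 'I_n.+1) : Prop :=
  path (adj E) ord0 p /\ uniq (ord0 :: p).

Definition recursive_tree E : Prop :=
  is_tree E /\
  forall p, root_path E p -> path (fun u v => u < v) ord0 p.

Definition child E u v : Prop :=
  exists2 p, root_path E (rcons p v) & last ord0 p = u.

Definition smallest_child E u v : Prop :=
  child E u v /\ forall w, child E u w -> v <= w.

Definition smallest_root_path E (p : seq 'I_n.+1) : Prop :=
  path (fun u v => `[< smallest_child E u v >]) ord0 p /\
  ~ exists w, child E (last ord0 p) w.

End RecursiveTree.

(* No tree on 0 vertices has a root.  [l] is an integer so that [l - 1] is not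
   truncated. *)
Definition R (N : nat) (l : int) (x : nat) : nat :=
  if N is n.+1 then
    #|[set E : {set {set 'I_n.+1}} | `[<
        [/\ recursive_tree E,
            Posz (num_leaves E) = l &
            exists2 p, smallest_root_path E p & last ord0 p = x :> nat] >] ]|
  else 0.

(* Main.v *)
(** A recursive tree is determined by its parent function [f], with [f 0 = 0]
and [f v < v] for [v != 0].  Deleting the leaf [x] at the end of the smallest
path and closing the gap in the labels is a bijection from the trees on [N]
vertices ending at [x] to all trees on [N - 1] vertices: in the other direction
[x] must be attached to the largest vertex [a < x] of the smallest path.  The
leaf count grows by one, unless [a] was itself a leaf.  For [x >= 2] this
happens exactly when the smaller tree ends before [x].  For [x = 1] it happens
when the root has degree 1, whereas the formula asks for vertex 1 to have
degree 1; exchanging the labels 0 and 1, which are always adjacent, matches the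
two conditions. *)

Require Import Defs.
From mathcomp Require Import all_boot all_order all_algebra.
From mathcomp Require Import perm boolp zify.

Set Implicit Arguments.
Unset Strict Implicit.
Unset Printing Implicit Defensive.

Lemma ord_ltn_neq n (i j : 'I_n) : i < j -> i != j.
Proof. by rewrite -(inj_eq val_inj) => /ltn_eqF->. Qed.

Lemma forall_ord_lift n (i : 'I_n.+1) (P : pred 'I_n.+1) :
  [forall j, P j] = P i && [forall j, P (lift i j)].
Proof.
apply/forallP/andP=> [P_all|[P_i /forallP P_lift] j].
  by split=> //; apply/forallP=> j.
by case: (unliftP i j) => [k|] ->.
Qed.

Lemma lift_ord0 n (i : 'I_n.+2) : i != ord0 -> lift i ord0 = ord0.
Proof.
by move=> i_neq0; apply: val_inj; rewrite /= /bump leqNgt lt0n i_neq0.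
Qed.

Section OrdinalLift.

Variables (n : nat) (i : 'I_n) (j k : 'I_n.-1).

Lemma lift_leq : (lift i j <= lift i k) = (j <= k).
Proof. exact: leq_bump2. Qed.

Lemma lift_ltn_pivot : (lift i j < i) = (j < i).
Proof. by rewrite /= /bump; lia. Qed.

Lemma lift_leq_pivot : (lift i j <= i) = (j < i).
Proof. by rewrite /= /bump; lia. Qed.

Lemma pivot_leq_lift : (i <= lift i j) = (i <= j).
Proof. by rewrite leqNgt lift_ltn_pivot -leqNgt. Qed.

End OrdinalLift.

Lemma sum_nat_eq_range k a b : \sum_(a <= i < b) (i == k) = (a <= k < b).
Proof.
rewrite -mem_index_iota -(count_uniq_mem k (iota_uniq a (b - a))) -sum1_count.
by rewrite [RHS]big_mkcond; apply: eq_bigr => i _; rewrite /=; case: eqP.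
Qed.

Section Connect.

Variables (T : finType) (e : rel T).
Implicit Types r u v w : T.

Lemma connect_ind r (P : T -> Prop) :
    P r -> (forall u v, connect e r u -> e u v -> P u -> P v) ->
  forall v, connect e r v -> P v.
Proof.
move=> Pr Pstep v /connectP[p e_p ->].
elim/last_ind: p e_p => // p w IH; rewrite rcons_path last_rcons.
by case/andP=> e_p e_w; apply: Pstep e_w (IH e_p); apply/connectP; exists p.
Qed.

Lemma connect_first_step u v :
  connect e u v -> u != v -> exists2 w, e u w & connect e w v.
Proof.
case/connectP=> -[_ ->|w p /= /andP[uw e_p] -> _]; first by rewrite eqxx.
by exists w => //; apply/connectP; exists p.
Qed.

Lemma connect_last_step u v :
  connect e u v -> u != v -> exists2 w, connect e u w & e w v.
Proof.
case/connectP=> p; case/lastP: p => [_ ->|p w]; first by rewrite eqxx.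
rewrite rcons_path last_rcons => /andP[e_p e_w] -> _.
by exists (last u p) => //; apply/connectP; exists p.
Qed.

Lemma connect_functional_total r u v :
    (forall a b c, e a b -> e a c -> b = c) ->
  connect e r u -> connect e r v -> connect e u v || connect e v u.
Proof.
move=> fun_e ru rv; move: u ru.
apply: connect_ind => [|u w _ uw]; first by rewrite rv.
have [<- _|ne_uv] := eqVneq u v; first by rewrite (connect1 uw) orbT.
case/orP=> [uv|vu]; last by rewrite (connect_trans vu (connect1 uw)) orbT.
have [c uc cv] := connect_first_step uv ne_uv.
by rewrite (fun_e _ _ _ uw uc) cv.
Qed.

End Connect.

Section Graph.

Variable V : finType.
Implicit Types (E : {set {set V}}) (u v w : V).

Lemma eq_set2 u v u' v' :
  ([set u; v] == [set u'; v']) =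
  (u == u') && (v == v') || (u == v') && (v == u').
Proof.
apply/eqP/orP=> [eq_uv|[|] /andP[/eqP-> /eqP->] //]; last exact: setUC.
have: (u \in [set u'; v']) && (v \in [set u'; v']).
  by rewrite -eq_uv set21 set22.
have: (u' \in [set u; v]) && (v' \in [set u; v]).
  by rewrite eq_uv set21 set22.
rewrite !inE ![u' == _]eq_sym ![v' == _]eq_sym.
by case: eqP; case: eqP; case: eqP; case: eqP; auto.
Qed.

Lemma adj_sym E : symmetric (adj E).
Proof. by move=> u v; rewrite /adj setUC. Qed.

Definition adj_avoiding E v : rel V :=
  [rel a b | [&& adj E a b, a != v & b != v]].

Lemma acyclic_neighbors_avoiding E u u' v :
    graph_acyclic E -> u != v -> adj E u v -> adj E u' v ->
  connect (adj_avoiding E v) u u' -> u = u'.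
Proof.
move=> acyclicE ne_uv uv u'v /connectP[p0 path_p0 last_p].
move: last_p u'v; case: (shortenP path_p0) => p path_p uniq_p _ -> last_v.
case: p path_p uniq_p last_v => // w p path_p uniq_p last_v.
have v_notin q a : path (adj_avoiding E v) a q -> v \notin q.
  elim: q a => //= b q IH a /andP[/and3P[_ _ ne_bv] /IH]; rewrite inE negb_or.
  by rewrite eq_sym ne_bv.
case: (acyclicE [:: v, u, w & p]) => //; apply/andP; split.
  rewrite /cycle rcons_path /= in last_v *.
  rewrite adj_sym uv last_v andbT; apply: sub_path path_p => a b.
  by case/and3P.
by rewrite cons_uniq uniq_p inE negb_or eq_sym ne_uv (v_notin _ _ path_p).
Qed.

End Graph.

Section OrdinalGraph.

Variable n : nat.
Implicit Types (E F : {set {set 'I_n}}) (u v w : 'I_n).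

Lemma simple_graph_eq E F :
    simple_graph E -> simple_graph F ->
    (forall u v, u < v -> adj E u v = adj F u v) ->
  E = F.
Proof.
have sub G H : simple_graph G ->
    (forall u v, u < v -> adj G u v = adj H u v) -> G \subset H.
  move=> simpleG eq_adj; apply/subsetP=> e eG.
  have /eqP/cards2P[u [v [ne_uv def_e]]] := simpleG e eG.
  rewrite {}def_e in eG *.
  have [lt_uv|lt_vu|/val_inj eq_uv] := ltngtP u v.
  - by rewrite -[_ \in H]eq_adj.
  - by rewrite setUC -[_ \in H]eq_adj // adj_sym.
  - by rewrite eq_uv eqxx in ne_uv.
move=> simpleE simpleF eq_adj; apply/eqP; rewrite eqEsubset !sub //.
by move=> u v /eq_adj.
Qed.

Definition unique_lower_neighbor E : Prop :=
  forall u u' v, u < v -> u' < v -> adj E u v -> adj E u' v -> u = u'.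

(* The two neighbours of its largest vertex on a cycle are distinct. *)
Lemma unique_lower_neighbor_acyclic E :
  unique_lower_neighbor E -> graph_acyclic E.
Proof.
move=> uniqE c size_c cycle_c.
have [m m_c m_max] : exists2 m, m \in c & forall w, w \in c -> w <= m.
  case: c size_c {cycle_c} => // a c _.
  have a_in : a \in a :: c := mem_head a c.
  by have [m m_in m_max] := arg_maxnP (fun v => v : nat) a_in; exists m.
have [i c' rot_c] := rot_to m_c.
have {cycle_c}: ucycle (adj E) (m :: c') by rewrite -rot_c rot_ucycle.
have {size_c}: 2 < size (m :: c') by rewrite -rot_c size_rot.
have {m_max}: {in c', forall w : 'I_n, w <= m}.
  by move=> w w_c'; apply: m_max; rewrite -(mem_rot i) rot_c inE w_c' orbT.
case: c' {rot_c} => // a c'; case/lastP: c' => // c' b max_m _ /andP[].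
rewrite /cycle rcons_path /= last_rcons => /andP[/andP[m_a _] b_m].
case/and3P=> m_notin a_notin _; case/negP: a_notin.
have below_m w : w \in a :: rcons c' b -> w < m.
  move=> w_in; rewrite ltn_neqAle max_m // andbT.
  by apply: contraNneq m_notin => /val_inj <-.
have b_in : b \in rcons c' b by rewrite mem_rcons mem_head.
have lt_bm : b < m by apply: below_m; rewrite inE b_in orbT.
have lt_am : a < m by apply: below_m; rewrite mem_head.
have a_m : adj E a m by rewrite adj_sym.
by rewrite (uniqE a b m lt_am lt_bm a_m b_m).
Qed.

End OrdinalGraph.

Section RecursiveTree.

Variable n : nat.
Implicit Types (E : {set {set 'I_n.+1}}) (u v w : 'I_n.+1).

Lemma root_path_exists E v :
  graph_connected E -> exists2 p, root_path E p & last ord0 p = v.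
Proof.
move=> /(_ ord0 v)/connectP[p0 path_p0 last_p].
by move: last_p; case: (shortenP path_p0) => p path_p uniq_p _ ->; exists p.
Qed.

Lemma recursive_tree_lower_neighbor E v :
  recursive_tree E -> v != ord0 -> exists2 u : 'I_n.+1, u < v & adj E u v.
Proof.
case=> -[_ connE _] incrE v_neq0.
have [p root_p last_p] := root_path_exists v connE.
case/lastP: p root_p last_p => [_ /= v0|p w root_p].
  by rewrite -v0 eqxx in v_neq0.
rewrite last_rcons => <-; exists (last ord0 p).
  by have := incrE _ root_p; rewrite rcons_path => /andP[].
by have [] := root_p; rewrite rcons_path => /andP[].
Qed.

Lemma recursive_tree_connect_below E v w :
  recursive_tree E -> w < v -> connect (adj_avoiding E v) ord0 w.
Proof.
case=> -[_ connE _] incrE lt_wv.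
have [p root_p last_p] := root_path_exists w connE.
apply/connectP; exists p => //; have [path_p _] := root_p.
have {incrE root_p} incr_p := incrE _ root_p.
elim/last_ind: p w path_p incr_p last_p lt_wv => // p a IH w.
rewrite !rcons_path last_rcons.
move=> /andP[path_p adj_a] /andP[incr_p lt_a] <- lt_av.
have lt_last_v := ltn_trans lt_a lt_av.
by rewrite (IH (last ord0 p)) //= /adj_avoiding /= adj_a !ord_ltn_neq.
Qed.

Lemma recursive_tree_unique_lower_neighbor E :
  recursive_tree E -> unique_lower_neighbor E.
Proof.
move=> recE u u' v lt_uv lt_u'v uv u'v; have [[_ _ acyclicE] _] := recE.
have avoiding_sym : symmetric (adj_avoiding E v).
  by move=> a b; rewrite /adj_avoiding /= adj_sym; congr andb; exact: andbC.
apply: (acyclic_neighbors_avoiding acyclicE (ord_ltn_neq lt_uv) uv u'v).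
apply: (connect_trans (y := ord0)); last exact: recursive_tree_connect_below.
by rewrite (sym_connect_sym avoiding_sym) recursive_tree_connect_below.
Qed.

End RecursiveTree.

Section ParentFunction.

Variable n : nat.
Implicit Types (f : {ffun 'I_n.+1 -> 'I_n.+1}) (u v w : 'I_n.+1).

(* As [0.-1 = 0], the root is its own parent. *)
Definition parent_fun f : bool := [forall v, f v <= v.-1].

Definition is_child f u v : bool := (v != ord0) && (f v == u).

Definition parent_graph f : {set {set 'I_n.+1}} :=
  [set [set f v; v] | v in predC1 ord0].

Definition smallest_step f : rel 'I_n.+1 :=
  fun u v => is_child f u v && [forall w, is_child f u w ==> (v <= w)].

Definition on_path f v : bool := connect (smallest_step f) ord0 v.

Definition path_end f v : bool := on_path f v && [forall w, ~~ is_child f v w].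

Definition path_last f : 'I_n.+1 := [arg max_(v > ord0 | on_path f v) v].

Definition deg f u : nat := (u != ord0) + \sum_v is_child f u v.

Definition leaves f : nat := \sum_u (deg f u == 1).

Lemma parent_funP f :
  reflect (f ord0 = ord0 /\ forall v, v != ord0 -> f v < v) (parent_fun f).
Proof.
apply: (iffP forallP) => [le_f|[f0 lt_f] v].
  split=> [|v]; first by apply/val_inj/eqP; rewrite -leqn0; apply: (le_f ord0).
  by rewrite -lt0n => v_gt0; rewrite -(prednK v_gt0); apply: le_f.
have [->|/lt_f lt_fv] := eqVneq v ord0; first by rewrite f0.
by rewrite -ltnS (ltn_predK lt_fv).
Qed.

Lemma adj_parent_graph f u v :
  adj (parent_graph f) u v = is_child f u v || is_child f v u.
Proof.
apply/imsetP/idP=> [[w]|].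
  rewrite inE => w_neq0 /eqP; rewrite eq_set2 /is_child.
  case/orP=> /andP[/eqP-> /eqP->].
    by rewrite w_neq0 eqxx.
  by rewrite w_neq0 eqxx orbT.
by case/orP=> /andP[w_neq0 /eqP <-]; [exists v | exists u => //; rewrite setUC].
Qed.

Lemma on_path0 f : on_path f ord0.
Proof. exact: connect0. Qed.

Lemma on_path_step f u v : on_path f u -> smallest_step f u v -> on_path f v.
Proof. by move=> u_path /connect1; apply: connect_trans. Qed.

Lemma on_path_parent f v : on_path f v -> v != ord0 ->
  on_path f (f v) /\ smallest_step f (f v) v.
Proof.
rewrite eq_sym => /connect_last_step/[apply] -[u u_path uv].
by have /andP[/andP[_ /eqP->] _] := uv.
Qed.

Lemma smallest_step_exists f u w :
  is_child f u w -> exists2 v, smallest_step f u v & v <= w.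
Proof.
move=> uw; have [v uv v_min] := arg_minnP (fun v => v : nat) uw.
exists v; last exact: v_min.
by rewrite /smallest_step uv; apply/forallP=> z; apply/implyP; apply: v_min.
Qed.

Lemma smallest_step_functional f u v w :
  smallest_step f u v -> smallest_step f u w -> v = w.
Proof.
case/andP=> uv /forallP v_min /andP[uw /forallP w_min]; apply/val_inj/eqP.
by rewrite eqn_leq (implyP (v_min w)) ?(implyP (w_min v)).
Qed.

End ParentFunction.

Section ParentFunctionTheory.

Variables (n : nat) (f : {ffun 'I_n.+1 -> 'I_n.+1}).
Hypothesis f_parent : parent_fun f.
Implicit Types (u v w : 'I_n.+1) (p : seq 'I_n.+1).

Lemma parent_fun0 : f ord0 = ord0.
Proof. by case/parent_funP: f_parent. Qed.

Lemma parent_fun_lt v : v != ord0 -> f v < v.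
Proof. by case/parent_funP: f_parent => _; apply. Qed.

Lemma is_child_lt u v : is_child f u v -> u < v.
Proof. by case/andP=> v_neq0 /eqP <-; apply: parent_fun_lt. Qed.

Lemma is_child_path_exists v :
  exists2 p, path (is_child f) ord0 p & last ord0 p = v.
Proof.
have [m] := ubnP (v : nat); elim: m v => // m IH v lt_vm.
have [->|v_neq0] := eqVneq v ord0; first by exists [::].
have lt_fv := parent_fun_lt v_neq0.
have [|p path_p last_p] := IH (f v); first by lia.
exists (rcons p v); last by rewrite last_rcons.
by rewrite rcons_path path_p last_p /is_child v_neq0 eqxx.
Qed.

Lemma adj_parent_graph_lt u v :
  u < v -> adj (parent_graph f) u v = is_child f u v.
Proof.
move=> lt_uv; rewrite adj_parent_graph orbC.
by case: (boolP (is_child f v u)) => // /is_child_lt; lia.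
Qed.

Lemma parent_graph_simple : simple_graph (parent_graph f).
Proof.
move=> e /imsetP[v v_neq0 ->].
by rewrite cards2 ord_ltn_neq // parent_fun_lt.
Qed.

(* A step towards the parent would revisit the previous vertex. *)
Lemma root_path_parent_graph p :
  root_path (parent_graph f) p <-> path (is_child f) ord0 p.
Proof.
split=> [|path_p]; last first.
  split; first by apply: sub_path path_p => u v; rewrite adj_parent_graph => ->.
  apply: (@sorted_uniq _ (fun u v => u < v)).
  - by move=> u v w; apply: ltn_trans.
  - by move=> u; apply: ltnn.
  - by apply: sub_path path_p => u v; apply: is_child_lt.
elim/last_ind: p => // p v IH [].
rewrite -rcons_cons !rcons_path rcons_uniq.
move=> /andP[adj_p adj_v] /andP[v_notin uniq_p].
have {adj_p uniq_p} path_p := IH (conj adj_p uniq_p); rewrite path_p /=.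
move: adj_v; rewrite adj_parent_graph => /orP[//|/andP[last_neq0 /eqP f_last]].
case/lastP: p path_p last_neq0 f_last v_notin {IH} => // p u.
rewrite rcons_path last_rcons => /andP[_ /andP[_ /eqP ->]] _ <- /negP[].
by rewrite -rcons_cons mem_rcons inE mem_last orbT.
Qed.

Lemma parent_graph_connected : graph_connected (parent_graph f).
Proof.
have connect_root v : connect (adj (parent_graph f)) ord0 v.
  have [p path_p <-] := is_child_path_exists v; apply/connectP; exists p => //.
  by case/root_path_parent_graph: path_p.
move=> u v; apply: connect_trans (connect_root v).
by rewrite (sym_connect_sym (adj_sym _)).
Qed.

Lemma parent_graph_recursive_tree : recursive_tree (parent_graph f).
Proof.
split=> [|p /root_path_parent_graph]; last first.
  by apply: sub_path => u v; apply: is_child_lt.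
split; [exact: parent_graph_simple | exact: parent_graph_connected |].
apply: unique_lower_neighbor_acyclic => u u' v lt_uv lt_u'v.
by rewrite !adj_parent_graph_lt // => /andP[_ /eqP <-] /andP[_ /eqP <-].
Qed.

Lemma child_parent_graph u v : child (parent_graph f) u v <-> is_child f u v.
Proof.
split=> [[p /root_path_parent_graph]|uv].
  by rewrite rcons_path => /andP[_ uv] <-.
have [p path_p last_p] := is_child_path_exists u.
exists p => //; apply/root_path_parent_graph.
by rewrite rcons_path path_p last_p.
Qed.

Lemma smallest_child_parent_graph u v :
  smallest_child (parent_graph f) u v <-> smallest_step f u v.
Proof.
split=> [[/child_parent_graph uv v_min]|/andP[uv /forallP v_min]].
  rewrite /smallest_step uv; apply/forallP=> w; apply/implyP=> uw.
  exact/v_min/child_parent_graph.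
split=> [|w /child_parent_graph uw]; first exact/child_parent_graph.
exact: implyP (v_min w) uw.
Qed.

Lemma smallest_root_path_parent_graph v :
  (exists2 p, smallest_root_path (parent_graph f) p & last ord0 p = v) <->
  path_end f v.
Proof.
have eq_step : (fun u v => `[< smallest_child (parent_graph f) u v >]) =2
    smallest_step f.
  by move=> a b; apply/asboolP/idP=> /smallest_child_parent_graph.
split=> [[p [path_p no_child] last_p]|].
  apply/andP; split.
    by apply/connectP; exists p; rewrite -?(eq_path eq_step).
  apply/forallP=> w; apply/negP=> vw; apply: no_child; exists w.
  by rewrite last_p; apply/child_parent_graph.
case/andP=> /connectP[p path_p ->] /forallP no_child.
exists p => //; split; first by rewrite (eq_path eq_step).
by case=> w /child_parent_graph; apply/negP.
Qed.

Lemma degree_parent_graph u : degree (parent_graph f) u = deg f u.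
Proof.
rewrite /degree /deg addnC -[X in X + _]big_mkcond sum1dep_card /=.
have -> : (u != ord0 : nat) = #|[set v | is_child f v u]|.
  have [->|u_neq0] := eqVneq u ord0.
    by apply/esym/eqP; rewrite cards_eq0; apply/eqP/setP=> v; rewrite !inE.
  transitivity #|[set f u]|; first by rewrite cards1.
  apply: eq_card => v.
  by rewrite !inE /is_child u_neq0 eq_sym.
rewrite -cardsUI [X in _ = _ + X](_ : _ = 0) ?addn0.
  by apply: eq_card => v; rewrite !inE adj_parent_graph.
apply/eqP; rewrite cards_eq0; apply/eqP/setP=> v; rewrite !inE.
by apply/andP=> -[/is_child_lt lt_uv /is_child_lt lt_vu]; lia.
Qed.

Lemma num_leaves_parent_graph : num_leaves (parent_graph f) = leaves f.
Proof.
rewrite /num_leaves /leaves -[RHS]big_mkcond /= sum1dep_card.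
by apply: eq_card => u; rewrite !inE degree_parent_graph.
Qed.

Lemma on_path_next u v :
    on_path f u -> on_path f v -> u < v ->
  exists2 w, smallest_step f u w & w <= v.
Proof.
have le_connect a b : connect (smallest_step f) a b -> a <= b.
  move: b; apply: connect_ind => // b c _ /andP[/is_child_lt lt_bc _] le_ab.
  exact: leq_trans le_ab (ltnW lt_bc).
move=> u_path v_path lt_uv.
have := connect_functional_total (@smallest_step_functional _ f) u_path v_path.
case/orP=> [uv|/le_connect]; last by rewrite leqNgt lt_uv.
have [w uw wv] := connect_first_step uv (ord_ltn_neq lt_uv).
by exists w => //; apply: le_connect.
Qed.

Lemma path_lastP : on_path f (path_last f) /\
  (forall v, on_path f v -> v <= path_last f).
Proof. by rewrite /path_last; case: arg_maxnP => //; apply: on_path0. Qed.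

Lemma path_endE v : path_end f v = (v == path_last f).
Proof.
have [last_path last_max] := path_lastP.
apply/andP/eqP=> [[v_path /forallP no_child]|->].
  apply/val_inj/eqP; rewrite eqn_leq last_max //= leqNgt.
  apply/negP=> lt_v_last.
  have [w /andP[vw _] _] := on_path_next v_path last_path lt_v_last.
  by have := no_child w; rewrite vw.
split=> //; apply/forallP=> w; apply/negP=> /smallest_step_exists[c step_c _].
have /andP[/is_child_lt lt_last_c _] := step_c.
by have := last_max c (on_path_step last_path step_c); rewrite leqNgt lt_last_c.
Qed.

Lemma deg_eq1_path_last v :
  v != ord0 -> on_path f v -> (deg f v == 1) = (v == path_last f).
Proof.
move=> v_neq0 v_path.
rewrite -path_endE /deg /path_end v_neq0 v_path eqSS sum_nat_eq0.
by apply: eq_forallb => w; rewrite eqb0.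
Qed.

End ParentFunctionTheory.

Section CountByParentFunction.

Variable n : nat.
Implicit Types (f g : {ffun 'I_n.+1 -> 'I_n.+1}) (E : {set {set 'I_n.+1}}).

Lemma parent_graph_inj : {in @parent_fun n &, injective (@parent_graph n)}.
Proof.
move=> f g f_parent g_parent eq_graph; apply/ffunP=> v.
have [->|v_neq0] := eqVneq v ord0; first by rewrite !parent_fun0.
have lt_fv := parent_fun_lt f_parent v_neq0.
have: is_child g (f v) v.
  rewrite -(adj_parent_graph_lt g_parent) // -eq_graph.
  by rewrite (adj_parent_graph_lt f_parent) // /is_child v_neq0 eqxx.
by case/andP=> _ /eqP.
Qed.

Lemma recursive_treeP E :
  recursive_tree E <-> exists2 f, parent_fun f & E = parent_graph f.
Proof.
split=> [recE|[f f_parent ->]]; last exact: parent_graph_recursive_tree.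
pose f := [ffun v : 'I_n.+1 =>
  odflt ord0 [pick u : 'I_n.+1 | (u < v) && adj E u v]].
have fP v : v != ord0 -> f v < v /\ adj E (f v) v.
  move=> v_neq0; rewrite ffunE; case: pickP => [u /andP[]|no_lower] //=.
  have [u lt_uv uv] := recursive_tree_lower_neighbor recE v_neq0.
  by have := no_lower u; rewrite lt_uv uv.
have f_parent : parent_fun f.
  apply/parent_funP; split=> [|v /fP[]//].
  by rewrite ffunE; case: pickP => // u /andP[].
exists f => //; apply: simple_graph_eq => [||u v lt_uv].
- by case: recE => -[].
- exact: parent_graph_simple.
have v_neq0 : v != ord0 by apply: contraTneq lt_uv => ->.
have [lt_fv fv] := fP v v_neq0.
rewrite adj_parent_graph_lt // /is_child v_neq0.
apply/idP/eqP=> [uv|<- //].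
exact: recursive_tree_unique_lower_neighbor recE _ _ _ lt_fv lt_uv fv uv.
Qed.

Lemma R_parent_fun (l : int) x :
  R n.+1 l x =
  \sum_(f : {ffun 'I_n.+1 -> 'I_n.+1} | parent_fun f)
    ((Posz (leaves f) == l) && (x == path_last f :> nat)).
Proof.
rewrite -big_mkcondr /= sum1dep_card /R -(card_in_imset (f := @parent_graph n)).
  apply: eq_card => E; rewrite inE; apply/asboolP/imsetP.
    case=> /recursive_treeP[f f_parent ->] <- [p path_p last_p]; exists f => //.
    rewrite inE f_parent num_leaves_parent_graph // eqxx -last_p.
    rewrite (inj_eq val_inj) -path_endE //.
    by apply/(smallest_root_path_parent_graph f_parent); exists p.
  case=> f; rewrite inE => /and3P[f_parent /eqP leaves_f /eqP->] ->.
  split; first exact: parent_graph_recursive_tree.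
    by rewrite num_leaves_parent_graph.
  have: path_end f (path_last f) by rewrite path_endE.
  case/(smallest_root_path_parent_graph f_parent)=> p path_p last_p.
  by exists p => //; rewrite last_p.
move=> f g; rewrite !inE => /andP[f_parent _] /andP[g_parent _].
exact: parent_graph_inj.
Qed.

Lemma sum_R_range (l : int) a b :
  \sum_(a <= i < b) R n.+1 l i =
  \sum_(f : {ffun 'I_n.+1 -> 'I_n.+1} | parent_fun f)
    ((Posz (leaves f) == l) && (a <= path_last f < b)).
Proof.
under eq_bigr do rewrite R_parent_fun.
rewrite exchange_big; apply: eq_bigr => f _.
by case: eqP => _ /=; [rewrite sum_nat_eq_range | rewrite big1].
Qed.

End CountByParentFunction.

Section LeafInsertion.

Variables (n : nat) (x : 'I_n.+2) (a : 'I_n.+1).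
Hypothesis x_neq0 : x != ord0.
Implicit Types (g : {ffun 'I_n.+1 -> 'I_n.+1}) (v w : 'I_n.+1).

Definition insert_leaf g : {ffun 'I_n.+2 -> 'I_n.+2} :=
  [ffun u => lift x (oapp g a (unlift x u))].

Lemma lift_neq0 v : (lift x v != ord0) = (v != ord0).
Proof. by rewrite -(lift_ord0 x_neq0) (inj_eq lift_inj). Qed.

Lemma insert_leaf_pivot g : insert_leaf g x = lift x a.
Proof. by rewrite ffunE unlift_none. Qed.

Lemma insert_leaf_lift g v : insert_leaf g (lift x v) = lift x (g v).
Proof. by rewrite ffunE liftK. Qed.

Lemma parent_fun_insert_leaf g :
  parent_fun (insert_leaf g) = parent_fun g && (a < x).
Proof.
have lift_x0 := lift_ord0 x_neq0.
have lift_ltn v w : (lift x v < lift x w) = (v < w) by rewrite !ltnNge lift_leq.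
apply/parent_funP/andP=> [[f0 lt_f]|[/parent_funP[g0 lt_g] lt_ax]].
  split; last by rewrite -(lift_ltn_pivot x) -(insert_leaf_pivot g) lt_f.
  apply/parent_funP; split=> [|v v_neq0].
    by apply: (@lift_inj _ x); rewrite -insert_leaf_lift lift_x0.
  by rewrite -lift_ltn -insert_leaf_lift lt_f // lift_neq0.
split=> [|u]; first by rewrite -{1}lift_x0 insert_leaf_lift g0.
case: (unliftP x u) => [v|] ->.
  by rewrite lift_neq0 insert_leaf_lift lift_ltn; apply: lt_g.
by rewrite insert_leaf_pivot lift_ltn_pivot.
Qed.

Lemma is_child_insert_leaf_lift g v w :
  is_child (insert_leaf g) (lift x v) (lift x w) = is_child g v w.
Proof. by rewrite /is_child lift_neq0 insert_leaf_lift (inj_eq lift_inj). Qed.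

Lemma is_child_insert_leaf_pivot g v :
  is_child (insert_leaf g) (lift x v) x = (v == a).
Proof.
by rewrite /is_child x_neq0 insert_leaf_pivot (inj_eq lift_inj) eq_sym.
Qed.

Lemma insert_leaf_childless g u : is_child (insert_leaf g) x u = false.
Proof. by rewrite /is_child ffunE lift_eqF andbF. Qed.

Lemma smallest_step_insert_leaf_lift g v w :
  smallest_step (insert_leaf g) (lift x v) (lift x w) =
  smallest_step g v w && ((v == a) ==> (w < x)).
Proof.
rewrite /smallest_step (forall_ord_lift x) is_child_insert_leaf_lift.
rewrite is_child_insert_leaf_pivot lift_leq_pivot andbCA [RHS]andbC.
congr (_ && (_ && _)).
by apply: eq_forallb => u; rewrite is_child_insert_leaf_lift lift_leq.
Qed.

Lemma smallest_step_insert_leaf_pivot g v :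
  smallest_step (insert_leaf g) (lift x v) x =
  (v == a) && [forall w, is_child g v w ==> (x <= w)].
Proof.
rewrite /smallest_step (forall_ord_lift x) is_child_insert_leaf_pivot.
rewrite leqnn implybT; congr andb.
by apply: eq_forallb => u; rewrite is_child_insert_leaf_lift pivot_leq_lift.
Qed.

Lemma on_path_of_insert_leaf g v :
  on_path (insert_leaf g) (lift x v) -> on_path g v.
Proof.
suff on_path_unlift u : on_path (insert_leaf g) u ->
    forall w, u = lift x w -> on_path g w.
  by move=> v_path; apply: on_path_unlift v_path v (erefl _).
move: u; apply: connect_ind => [w|u1 u2 _ u12 IH w def_u2].
  by rewrite -(lift_ord0 x_neq0) => /lift_inj <-; apply: on_path0.
rewrite {}def_u2 in u12; case: (unliftP x u1) => [v1 def_u1|def_u1]; last first.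
  by move: u12; rewrite def_u1 /smallest_step insert_leaf_childless.
move: u12; rewrite def_u1 smallest_step_insert_leaf_lift => /andP[step_w _].
exact: on_path_step (IH v1 def_u1) step_w.
Qed.

Lemma on_path_insert_leaf g v : parent_fun g -> on_path g v -> v <= a ->
  on_path (insert_leaf g) (lift x v).
Proof.
move=> g_parent; move: v; apply: connect_ind => [_|u v _ uv IH le_va].
  by rewrite (lift_ord0 x_neq0) on_path0.
have lt_uv : u < v by have /andP[/(is_child_lt g_parent)] := uv.
have lt_ua := leq_trans lt_uv le_va.
apply: on_path_step (IH (ltnW lt_ua)) _.
by rewrite smallest_step_insert_leaf_lift uv (negPf (ord_ltn_neq lt_ua)).
Qed.

Lemma deg_insert_leaf_pivot g : deg (insert_leaf g) x = 1.
Proof.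
by rewrite /deg x_neq0 big1 // => u _; rewrite insert_leaf_childless.
Qed.

Lemma deg_insert_leaf_lift g v :
  deg (insert_leaf g) (lift x v) = deg g v + (v == a).
Proof.
rewrite /deg lift_neq0 -addnA; congr (_ + _).
rewrite (bigD1_ord x) //= is_child_insert_leaf_pivot addnC; congr (_ + _).
by apply: eq_bigr => w _; rewrite is_child_insert_leaf_lift.
Qed.

Lemma leaves_insert_leaf g :
  0 < deg g a -> leaves (insert_leaf g) + (deg g a == 1) = (leaves g).+1.
Proof.
move=> deg_a; rewrite /leaves (bigD1_ord x) //= deg_insert_leaf_pivot eqxx.
rewrite add1n addSn; congr _.+1; rewrite (bigD1 a) // [RHS](bigD1 a) //=.
rewrite deg_insert_leaf_lift eqxx addn1 eqSS eqn0Ngt deg_a add0n addnC.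
congr (_ + _).
by apply: eq_bigr => v /negPf ne_va; rewrite deg_insert_leaf_lift ne_va addn0.
Qed.

End LeafInsertion.

Section EndOfPathInsertion.

Variables (n : nat) (x : 'I_n.+2).
Hypothesis x_neq0 : x != ord0.
Implicit Types (g : {ffun 'I_n.+1 -> 'I_n.+1}) (f : {ffun 'I_n.+2 -> 'I_n.+2}).
Implicit Types a v w : 'I_n.+1.

Lemma childless_insert_leaf f : parent_fun f -> (forall u, ~~ is_child f x u) ->
  exists a g, [/\ parent_fun g, a < x & f = insert_leaf x a g].
Proof.
move=> f_parent childless.
have f_neq_x u : x != f u.
  have [->|u_neq0] := eqVneq u ord0; first by rewrite parent_fun0.
  by have := childless u; rewrite /is_child u_neq0 eq_sym.
pose drop u := odflt ord0 (unlift x (f u)).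
have dropK u : lift x (drop u) = f u.
  by rewrite /drop; have [v -> ->] := unlift_some (f_neq_x u).
exists (drop x), [ffun v => drop (lift x v)].
have def_f : f = insert_leaf x (drop x) [ffun v => drop (lift x v)].
  apply/ffunP=> u; rewrite ffunE.
  by case: (unliftP x u) => [v|] ->; rewrite /= ?ffunE dropK.
by have := f_parent; rewrite {1}def_f parent_fun_insert_leaf // => /andP[].
Qed.

Definition attach_point g : 'I_n.+1 :=
  [arg max_(v > ord0 | on_path g v && (v < x)) v].

Lemma attach_pointP g :
  [/\ on_path g (attach_point g), attach_point g < x &
      forall v, on_path g v -> v < x -> v <= attach_point g].
Proof.
rewrite /attach_point; case: arg_maxnP; first by rewrite on_path0 lt0n.
move=> a /andP[a_path lt_ax] a_max; split=> // v v_path lt_vx.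
by apply: a_max; rewrite v_path.
Qed.

(* If [a] lies on the smallest path but below the attachment point, then the
   path continues from [a] through a vertex smaller than [x]. *)
Lemma path_end_insert_leaf g a : parent_fun g -> a < x ->
  path_end (insert_leaf x a g) x = (a == attach_point g).
Proof.
move=> g_parent lt_ax; have [b_path lt_bx b_max] := attach_pointP g.
apply/andP/eqP=> [[x_path _]|def_a].
  have [] := on_path_parent x_path x_neq0.
  rewrite insert_leaf_pivot => /(on_path_of_insert_leaf x_neq0) a_path.
  rewrite smallest_step_insert_leaf_pivot // eqxx => /forallP x_min.
  apply/val_inj/eqP; rewrite eqn_leq b_max //= leqNgt; apply/negP=> lt_ab.
  have [c /andP[ac _] le_cb] := on_path_next g_parent a_path b_path lt_ab.
  by have := x_min c; rewrite ac leqNgt (leq_ltn_trans le_cb).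
split; last by apply/forallP=> u; rewrite insert_leaf_childless.
have a_path : on_path g a by rewrite def_a.
apply: on_path_step (on_path_insert_leaf x_neq0 g_parent a_path (leqnn a)) _.
rewrite smallest_step_insert_leaf_pivot // eqxx; apply/forallP=> w.
apply/implyP; case/smallest_step_exists=> c ac le_cw; apply: leq_trans le_cw.
have /andP[/(is_child_lt g_parent) lt_ac _] := ac.
rewrite leqNgt; apply: contraTN lt_ac => lt_cx.
by rewrite -leqNgt def_a b_max // (on_path_step a_path).
Qed.

Definition insert_path_end g := insert_leaf x (attach_point g) g.

Lemma insert_path_end_inj : injective insert_path_end.
Proof.
move=> g h eq_gh; apply/ffunP=> v; apply: (@lift_inj _ x).
have := congr1 (fun f => fun_of_fin f (lift x v)) eq_gh.
by rewrite !insert_leaf_lift.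
Qed.

Lemma insert_path_endP f :
  parent_fun f /\ path_end f x <->
  exists2 g, parent_fun g & f = insert_path_end g.
Proof.
split=> [[f_parent end_f]|[g g_parent ->]].
  have /andP[_ /forallP childless] := end_f.
  have [a [g [g_parent lt_ax def_f]]] :=
    childless_insert_leaf f_parent childless.
  exists g => //; rewrite def_f; congr insert_leaf.
  by apply/eqP; rewrite -path_end_insert_leaf // -def_f.
have [_ lt_ax _] := attach_pointP g.
by rewrite parent_fun_insert_leaf // path_end_insert_leaf // g_parent.
Qed.

Lemma R_insert_path_end (l : int) :
  R n.+2 l x =
  \sum_(g : {ffun 'I_n.+1 -> 'I_n.+1} | parent_fun g)
    (Posz (leaves (insert_path_end g)) == l).
Proof.
rewrite R_parent_fun -!big_mkcondr /= !sum1dep_card.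
rewrite -[RHS](card_imset _ insert_path_end_inj).
apply: eq_card => f; rewrite inE (inj_eq val_inj); apply/and3P/imsetP.
  case=> f_parent leaves_f; rewrite -path_endE // => end_f.
  have [g g_parent def_f] := (insert_path_endP f).1 (conj f_parent end_f).
  by exists g => //; rewrite inE g_parent -def_f.
case=> g; rewrite inE => /andP[g_parent leaves_g] def_f.
have [|f_parent end_f] := (insert_path_endP f).2; first by exists g.
by rewrite -path_endE // f_parent end_f def_f.
Qed.

End EndOfPathInsertion.

Section Swap01.

Variable n : nat.
Implicit Types (g : {ffun 'I_n.+2 -> 'I_n.+2}) (u v w : 'I_n.+2).

Definition vertex1 : 'I_n.+2 := Ordinal (isT : 1 < n.+2).

Lemma parent_fun_vertex1 g : parent_fun g -> g vertex1 = ord0.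
Proof.
move=> g_parent; apply/val_inj/eqP; rewrite -leqn0 -ltnS.
exact: parent_fun_lt.
Qed.

Lemma on_path_vertex1 g : parent_fun g -> on_path g vertex1.
Proof.
move=> g_parent; apply: on_path_step (on_path0 g) _.
rewrite /smallest_step /is_child parent_fun_vertex1 // eqxx; apply/forallP=> w.
by apply/implyP=> /andP[w_neq0 _]; rewrite lt0n.
Qed.

Lemma path_last_gt0 g : parent_fun g -> 0 < path_last g.
Proof.
move=> g_parent; have [_ last_max] := path_lastP g.
exact: last_max _ (on_path_vertex1 g_parent).
Qed.

(* Besides its children among 2, 3, ..., every vertex has one neighbour: the
   root has 1, and the others have their parent. *)
Lemma deg_sum_gt1 g v :
  parent_fun g -> deg g v = (\sum_(w : 'I_n.+2 | 1 < w) (g w == v)).+1.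
Proof.
move=> g_parent; rewrite /deg (bigD1 vertex1) //= /is_child.
rewrite parent_fun_vertex1 // addnA [X in X + _](_ : _ = 1) ?add1n; last first.
  by rewrite [ord0 == v]eq_sym; case: eqVneq.
congr _.+1; rewrite big_mkcond [RHS]big_mkcond; apply: eq_bigr => w _.
by rewrite -!(inj_eq val_inj) /=; case: (nat_of_ord w) => [|[|m]].
Qed.

Lemma deg_gt0 g v : parent_fun g -> 0 < deg g v.
Proof. by move=> g_parent; rewrite deg_sum_gt1. Qed.

Definition swap01 g : {ffun 'I_n.+2 -> 'I_n.+2} :=
  [ffun v : 'I_n.+2 => if 1 < v then tperm ord0 vertex1 (g v) else g v].

Lemma swap01K : involutive swap01.
Proof.
by move=> g; apply/ffunP=> v; rewrite !ffunE; case: (1 < v); rewrite ?tpermK.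
Qed.

Lemma parent_fun_swap01 g : parent_fun (swap01 g) = parent_fun g.
Proof.
suff parent_swap h : parent_fun h -> parent_fun (swap01 h).
  by apply/idP/idP=> [/parent_swap|/parent_swap//]; rewrite swap01K.
case/parent_funP=> h0 lt_h; apply/parent_funP; split=> [|v v_neq0].
  by rewrite ffunE.
rewrite ffunE; have lt_hv := lt_h v v_neq0; case: ifP => // lt_1v.
by case: tpermP => // _; apply: ltnW.
Qed.

Lemma deg_swap01 g u :
  parent_fun g -> deg (swap01 g) u = deg g (tperm ord0 vertex1 u).
Proof.
move=> g_parent; rewrite !deg_sum_gt1 ?parent_fun_swap01 //; congr _.+1.
apply: eq_bigr => w lt_1w; rewrite ffunE lt_1w.
by rewrite -(inj_eq (@perm_inj _ (tperm ord0 vertex1))) tpermK.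
Qed.

Lemma leaves_swap01 g : parent_fun g -> leaves (swap01 g) = leaves g.
Proof.
move=> g_parent.
rewrite /leaves [RHS](reindex_inj (@perm_inj _ (tperm ord0 vertex1))).
by apply: eq_bigr => u _; rewrite deg_swap01.
Qed.

End Swap01.

Section Recurrence.

Variable n : nat.
Implicit Types (g : {ffun 'I_n.+2 -> 'I_n.+2}) (l : int) (x : 'I_n.+3).

Lemma R_attach_point l x : x != ord0 ->
  R n.+3 l x =
  \sum_(g : {ffun 'I_n.+2 -> 'I_n.+2} | parent_fun g)
    (Posz (leaves g) == if deg g (attach_point x g) == 1 then l else (l - 1)%R).
Proof.
move=> x_neq0; rewrite R_insert_path_end //; apply: eq_bigr => g g_parent.
have := leaves_insert_leaf x_neq0 (deg_gt0 (attach_point x g) g_parent).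
by rewrite /insert_path_end; case: ifP => _; lia.
Qed.

Lemma deg_attach_point_eq1 x g : 1 < x -> parent_fun g ->
  (deg g (attach_point x g) == 1) = (path_last g < x).
Proof.
move=> gt1_x g_parent.
have x_neq0 : x != ord0 by apply: contraTneq gt1_x => ->.
have [a_path lt_ax a_max] := attach_pointP x_neq0 g.
have a_neq0 : attach_point x g != ord0.
  by apply: contraTneq (a_max _ (on_path_vertex1 g_parent) gt1_x) => ->.
have [last_path last_max] := path_lastP g.
rewrite deg_eq1_path_last //; apply/eqP/idP=> [<- //|lt_last_x].
by apply/val_inj/eqP; rewrite eqn_leq last_max // a_max.
Qed.

Lemma attach_point_vertex1 g : attach_point (vertex1 n.+1) g = ord0.
Proof.
have [_ lt_a1 _] := attach_pointP (isT : vertex1 n.+1 != ord0) g.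
by apply/val_inj/eqP; rewrite -leqn0.
Qed.

Lemma R_recurrence_gt1 l x : 1 < x ->
  R n.+3 l x =
  \sum_(x <= i < n.+2) R n.+2 (l - 1)%R i + \sum_(1 <= i < x) R n.+2 l i.
Proof.
move=> gt1_x; have x_neq0 : x != ord0 by apply: contraTneq gt1_x => ->.
rewrite R_attach_point // !sum_R_range -big_split.
apply: eq_bigr => g g_parent /=; rewrite deg_attach_point_eq1 // ltn_ord.
rewrite path_last_gt0 // andbT [x <= _]leqNgt.
by case: (path_last g < x); rewrite /= ?andbT ?andbF ?addn0.
Qed.

(* The vertex 1 is attached to the root, whereas the right-hand side tests the
   degree of 1: [swap01] exchanges the two degrees. *)
Lemma R_recurrence_eq1 l :
  R n.+3 l 1 = \sum_(2 <= i < n.+2) R n.+2 (l - 1)%R i + R n.+2 l 1.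
Proof.
have -> : R n.+2 l 1 = \sum_(1 <= i < 2) R n.+2 l i by rewrite big_nat1.
rewrite !sum_R_range -big_split /= [LHS](@R_attach_point l (vertex1 n.+1)) //.
rewrite (reindex_inj (inv_inj (@swap01K n))) /=.
apply: eq_big => [g|g]; rewrite parent_fun_swap01 // => g_parent.
rewrite attach_point_vertex1 leaves_swap01 // deg_swap01 // tpermL.
rewrite deg_eq1_path_last ?on_path_vertex1 // -(inj_eq val_inj) /=.
by rewrite ltn_ord; have := path_last_gt0 g_parent; case: ifP; lia.
Qed.

End Recurrence.

Theorem theorem7p6 (N : nat) (l : int) (x : nat)
  (hN : 2 < N) (hx1 : 1 <= x) (hxN : x <= N - 1) :
  R N l x =
    \sum_(maxn x 2 <= i < (N - 2).+1) R (N - 1) (l - 1)%R i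
    + \sum_(1 <= i < (maxn (x - 1) 1).+1) R (N - 1) l i.
Proof.
case: N hN hxN => [|[|[|n]]] // _; rewrite !subSS !subn0 => hxN.
case: x hx1 hxN => [|[|x]] // _ hxN; first by rewrite big_nat1 R_recurrence_eq1.
exact: R_recurrence_gt1 l (Ordinal (hxN : x.+2 < n.+3)) isT.
Qed.
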